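(* Let $(\mathcal A,\varphi,\psi,B)$ be an operator-valued conditional probability space and let $a,b\in\mathcal A$ be conditionally free with $\varphi(a)=\varphi(b)=\psi(a)=\psi(b)=1$. For $x\in\{a,b,ab\}$ let $K_x,K_x^c\in\mathbb C_0[[\mathrm{End}\,B]]$ be the series of free cumulants (with respect to $\psi$) and of conditionally free cumulants of $x$, and let $T_x,T^c_x\in\mathbb C_0[[\mathrm{End}\,B]]$ be the series defined by $$K_x=T_x\circ(I\cdot K_x),\qquad K_x^c=T_x^c\circ(I\cdot K_x).$$ Then $$T_{ab}=\big(T_a\circ(T_b\cdot I\cdot T_b^{-1})\big)\cdot T_b,\qquad T^c_{ab}=\big(T^c_a\circ(T_b\cdot I\cdot T_b^{-1})\big)\cdot T^c_b .$$
   Context: Operator-valued conditional probability space $(\mathcal A,\varphi,\psi,B)$: a unital complex algebra $\mathcal A$ containing the unital algebra $B$ as a unital subalgebra (so $B$ acts on both sides), and two unital $B$-bimodule maps $\varphi,\psi\colon\mathcal A\to B$. For $a\in\mathcal A$, $\langle a\rangle$ is the subalgebra generated by $B$ and $a$. Elements $a_1,a_2$ are conditionally free if, whenever $p_j\in\langle a_{i_j}\rangle$, $\psi(p_j)=0$, $i_j\ne i_{j+1}$, one has $\psi(p_1\cdots p_n)=0$ and $\varphi(p_1\cdots p_n)=\varphi(p_1)\cdots\varphi(p_n)$. Multilinear series: $\mathbb C_0[[\mathrm{End}\,B]]$ is the set of $F=1+\sum_{n\ge1}F^{(n)}$ with $F^{(n)}\colon B^{\otimes n}\to B$ linear (degree-zero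 part $F^{(0)}=1\in B$). It is a group for the Cauchy product $(F\cdot G)^{(n)}(b_1,\dots,b_n)=\sum_{k=0}^nF^{(k)}(b_1,\dots,b_k)G^{(n-k)}(b_{k+1},\dots,b_n)$; $F^{-1}$ denotes the inverse for this product. The same product is used for series with arbitrary degree-zero part. $I$ is the series whose only nonzero component is $I^{(1)}=\mathrm{id}_B$. For a series $\alpha$ with $\alpha^{(0)}=0$, $(F\circ\alpha)^{(0)}=F^{(0)}$ and $(F\circ\alpha)^{(n)}=\sum_{k\ge1,\,q_1+\dots+q_k=n,\,q_i\geq 1}F^{(k)}\circ(\alpha^{(q_1)}\otimes\cdots\otimes\alpha^{(q_k)})$. The series $T_x,T_x^c$ are uniquely determined since $I\cdot K_x$ is invertible for $\circ$. Cumulants of $x$ with $\varphi(x)=\psi(x)=1$: let $C^\varphi_x,C^\psi_x$ be the series with zero degree-zero part whose degree-$(n+1)$ component is $(b_0,\dots,b_n)\mapsto\varphi(b_0xb_1x\cdots xb_n)$, resp. $\psi(b_0xb_1x\cdots xb_n)$, $n\ge0$. Then $K_x,K^c_x\in\mathbb C_0[[\mathrm{End}\,B]]$ are the unique series with $C^\psi_x=I+I\cdot(K_x\circ C_x^\psi)\cdot C_x^\psi$ and $C^\varphi_x=I+I\cdot(K_x^c\circ C_x^\psi)\cdot C_x^\varphi$. (Equivalently $K_x^{(n)}(b_1,\dots,b_n)=\kappa_{n+1}(xb_1,\dots,xb_n,x)$ and similarly for $K^c_x$ with conditionally free cumulants.) *)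

(* Defs.v *)
From HB Require Import structures.
From mathcomp Require Import all_boot all_order all_algebra.
From mathcomp Require Import complex.
From mathcomp Require Import reals.
Set Implicit Arguments.
Unset Strict Implicit.
Unset Printing Implicit Defensive.
Import GRing.Theory.
Local Open Scope ring_scope.

(* A series F = F^(0) + F^(1) + F^(2) + ... with F^(n) a C-multilinear map     *)
(* B^n -> B is encoded as one function F on finite sequences:                  *)
(*   F [:: b_1; ...; b_n] = F^(n)(b_1, ..., b_n), and F [::] = F^(0).          *)
(* Linear maps on the n-fold tensor power of B are identified with             *)
(* n-multilinear maps, and equality of series is pointwise equality.           *)
Section Series.
Variables (C : comNzRingType) (B : algType C).
Implicit Types (F G H : seq B -> B) (s t : seq B).

Definition multilinear F : Prop :=
  forall s t (c : C) (x y : B),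
    F (s ++ (c *: x + y) :: t) = c *: F (s ++ x :: t) + F (s ++ y :: t).

(* Membership in C_0[[End B]]. *)
Definition in_C0 F : Prop := multilinear F /\ F [::] = 1.

Definition sone s : B := if s is [::] then 1 else 0.

Definition sI s : B := if s is [:: b] then b else 0.

Definition smul F G s : B :=
  \sum_(k < (size s).+1) F (take k s) * G (drop k s).

(* The sum over all (q_1, ..., q_k) with q_i >= 1 and q_1 + ... + q_k = n;     *)
(* each k <= n and q_i <= n, and reshape q s cuts s = (b_1, ..., b_n) into     *)
(* consecutive blocks of lengths q_1, ..., q_k.  For n = 0 only k = 0 is left, *)
(* giving F^(0); for n >= 1 the term k = 0 is void.                            *)
Definition scomp F G s : B :=
  let n := size s in
  \sum_(k < n.+1)
    \sum_(q : k.-tuple 'I_n.+1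
         | all (fun i : 'I_n.+1 => 0 < i)%N q && (\sum_(i <- q) i == n)%N)
       F [seq G r | r <- reshape [seq val i | i <- q] s].

(* Solves F . G = 1 for G degree by degree when F^(0) = 1; see smulrV, smulVr. *)
Fixpoint sinv F s : B :=
  if s is x :: s' then
    - \sum_(k < (size s').+1) F (x :: take k s') * sinv F (drop k s')
  else 1.

Lemma smul_cons F G x s :
  smul F G (x :: s) = F [::] * G (x :: s) + smul (fun t => F (x :: t)) G s.
Proof. by rewrite /smul big_ord_recl take0. Qed.

Lemma eq_smul F F' G G' : F =1 F' -> G =1 G' -> smul F G =1 smul F' G'.
Proof. by move=> eF eG s; apply: eq_bigr => k _; rewrite eF eG. Qed.

Lemma smulA F G H : smul F (smul G H) =1 smul (smul F G) H.
Proof.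
move=> s; elim: s F G => [|x s IHs] F G.
  by rewrite /smul /= !big_ord1 /= mulrA.
rewrite !smul_cons IHs mulrDr mulrA -addrA.
congr (_ + _); first by rewrite /smul big_ord1.
rewrite /smul mulr_sumr -big_split /=; apply: eq_bigr => k _.
rewrite -/(smul G H) -/(smul F G (x :: take k s)) smul_cons.
by rewrite mulrDl mulrA.
Qed.

Lemma smul1r F : smul sone F =1 F.
Proof.
case=> [|x s]; first by rewrite /smul big_ord1 mul1r.
by rewrite smul_cons mul1r /smul big1 ?addr0 // => k _; rewrite mul0r.
Qed.

Lemma smulr1 F : smul F sone =1 F.
Proof.
move=> s; elim: s F => [|x s IHs] F; first by rewrite /smul big_ord1 mulr1.
by rewrite smul_cons IHs mulr0 add0r.
Qed.

Lemma smulrV F : F [::] = 1 -> smul F (sinv F) =1 sone.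
Proof.
move=> F0 [|x s]; first by rewrite /smul big_ord1 /= F0 mulr1.
by rewrite smul_cons F0 mul1r /= addNr.
Qed.

Lemma smulVr F : F [::] = 1 -> smul (sinv F) F =1 sone.
Proof.
move=> F0 s; set G := sinv F; have G0 : G [::] = 1 by [].
rewrite -[LHS]smulr1 -(eq_smul (frefl _) (smulrV G0)) smulA.
rewrite (eq_smul (F' := G) (G' := sinv G)) //; first exact: smulrV.
move=> t; rewrite -smulA (eq_smul (frefl _) (smulrV F0)); exact: smulr1.
Qed.

End Series.

Arguments sI {C B} s.

Declare Scope series_scope.
Delimit Scope series_scope with ser.
Notation "F \*s G" := (smul F G) (at level 40, left associativity)
  : series_scope.
Notation "F \os G" := (scomp F G) (at level 50, no associativity)
  : series_scope.

Section CondProbSpace.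
Variables (C : comNzRingType) (A : algType C).
(* B is a unital subalgebra of A, with inclusion \val : B -> A. *)
Variables (P : {pred A}) (B : subAlgType P).
Implicit Types (phi psi : {linear A -> B}) (x : A).

Definition unital_bimodule_map phi : Prop :=
  phi 1 = 1 /\
  forall (b b' : B) x, phi (\val b * x * \val b') = b * phi x * b'.

Inductive gen_subalg x : A -> Prop :=
| gen_base (b : B) : gen_subalg x (\val b)
| gen_elt : gen_subalg x x
| gen_add y z : gen_subalg x y -> gen_subalg x z -> gen_subalg x (y + z)
| gen_mul y z : gen_subalg x y -> gen_subalg x z -> gen_subalg x (y * z)
| gen_scale (c : C) y : gen_subalg x y -> gen_subalg x (c *: y).

(* The nonempty word p_1 ... p_n is the list of the pairs (i_j, p_j), where    *)
(* i_j = false stands for a1 and i_j = true for a2.                            *)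
Definition cond_free phi psi (a1 a2 : A) : Prop :=
  forall w : seq (bool * A),
    w != [::] ->
    sorted (fun p q => p.1 != q.1) w ->
    (forall p, p \in w ->
       gen_subalg (if p.1 then a2 else a1) p.2 /\ psi p.2 = 0) ->
    psi (\prod_(p <- w) p.2) = 0 /\
    phi (\prod_(p <- w) p.2) = \prod_(p <- w) phi p.2.

(* (b_0, ..., b_n) |-> phi (b_0 x b_1 x ... x b_n), with zero constant term. *)
Definition moment_series phi x (s : seq B) : B :=
  if s is b0 :: s' then phi (\val b0 * \prod_(b <- s') (x * \val b)) else 0.

Definition free_cumulant_series psi x (K : seq B -> B) : Prop :=
  let Cpsi := moment_series psi x in
  in_C0 K /\
  Cpsi =1 sI \+ (sI \*s (K \os Cpsi) \*s Cpsi)%ser.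

Definition cfree_cumulant_series phi psi x (Kc : seq B -> B) : Prop :=
  let Cphi := moment_series phi x in
  let Cpsi := moment_series psi x in
  in_C0 Kc /\
  Cphi =1 sI \+ (sI \*s (Kc \os Cpsi) \*s Cphi)%ser.

End CondProbSpace.

(* Main.v *)
(* Write z for the series I. For T = T_x the resolvent                         *)
(*   E_x = (1 + z - z T^-1 x)^-1,                                              *)
(* a series with coefficients in <x>, satisfies psi(E_x) = 1, which determines *)
(* T_x, and phi(E_x) (1 + z - z T^-1 T^c_x) = 1, which then determines T^c_x;  *)
(* both are the cumulant equations after the substitution of (I K_x) o C_x for *)
(* z, which can be cancelled. Put t = T_b, s = T_a o (t z t^-1),               *)
(*   1 + alpha = t^-1 (E_a o (t z t^-1)) t,   1 + z beta = E_b,                *)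
(* and gamma = (1 + z) beta. Purely algebraically,                             *)
(*   (1 + z - z (s t)^-1 a b)^-1 = E_b (1 - alpha gamma)^-1 (1 + alpha).       *)
(* The coefficients of alpha, z beta and gamma are centred elements of <a>,    *)
(* <b> and <b>, so the right-hand side expands into alternating centred words, *)
(* on which psi and phi are multiplicative. The same identity, read with       *)
(* T^c_a and T^c_b in place of a and b, then shows that s t and                *)
(* (T^c_a o (t z t^-1)) T^c_b satisfy the two conditions that characterise     *)
(* T_ab and T^c_ab.                                                            *)

Require Import Defs.
From HB Require Import structures.
From mathcomp Require Import all_boot all_order all_algebra.
From mathcomp Require Import complex.
From mathcomp Require Import boolp functions.
From mathcomp Require Import reals.
Set Implicit Arguments.
Unset Strict Implicit.
Unset Printing Implicit Defensive.
Import GRing.Theory.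
Local Open Scope ring_scope.

(** Under the Cauchy product, substitution is a ring endomorphism ([scompose_is_monoid_morphism]),
    injective when the substituted series has identity linear part ([scompose_inj]). The cumulant
    equations therefore turn into one relation, [smap_resolvent], between [T], [Tc] and the image of
    the resolvent [T_resolvent T x]. Read for [psi], with [Tc] equal to [T], the relation pins down
    [T] ([resolvent_inj]); read for [phi], it then pins down [Tc] ([sub1_cancel]).

    So it suffices that the two right-hand sides of the theorem satisfy the relation for [a * b],
    which is [smap_resolvent_mul]. There the resolvent of [a * b] factors by [sub1_mul_factor]. Its
    factors expand into alternating centred words, on which conditional freeness makes both maps
    multiplicative ([smap_alternating]). The image is a product in series over [B], and the same
    factorisation, read backwards with the [Tc] series in place of [a] and [b], reassembles it. *)

Section Cuts.
Variables (X : Type) (V : nmodType).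
Implicit Types (s : seq X).

(** The Cauchy product and the choice of the first block in a composition are both sums of this
    shape. *)
Definition cuts (Phi : seq X -> seq X -> V) s : V :=
  \sum_(k < (size s).+1) Phi (take k s) (drop k s).

Lemma cuts_nil Phi : cuts Phi [::] = Phi [::] [::].
Proof. by rewrite /cuts big_ord1. Qed.

Lemma cuts_cons Phi x s :
  cuts Phi (x :: s) = Phi [::] (x :: s) + cuts (fun u v => Phi (x :: u) v) s.
Proof. by rewrite /cuts big_ord_recl. Qed.

Lemma eq_cuts Phi Psi s :
  (forall u v, (size u + size v = size s)%N -> Phi u v = Psi u v) ->
  cuts Phi s = cuts Psi s.
Proof.
move=> e; apply: eq_bigr => k _; apply: e.
by rewrite -size_cat cat_take_drop.
Qed.

Lemma cutsD Phi Psi s :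
  cuts (fun u v => Phi u v + Psi u v) s = cuts Phi s + cuts Psi s.
Proof. exact: big_split. Qed.

Lemma cuts0 Phi s :
  (forall u v, (size u + size v = size s)%N -> Phi u v = 0) -> cuts Phi s = 0.
Proof. by move=> /eq_cuts ->; rewrite /cuts big1. Qed.

Lemma cutsA (Phi : seq X -> seq X -> seq X -> V) s :
  cuts (fun u v => cuts (fun u1 u2 => Phi u1 u2 v) u) s =
  cuts (fun u v => cuts (fun v1 v2 => Phi u v1 v2) v) s.
Proof.
elim: s Phi => [|x s IHs] Phi; first by rewrite !cuts_nil.
rewrite !cuts_cons cuts_nil -addrA -IHs -cutsD; congr (_ + _).
by apply: eq_cuts => u v _; rewrite cuts_cons.
Qed.

End Cuts.

Lemma raddf_cuts (X : Type) (V W : nmodType) (f : {additive V -> W})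
    (Phi : seq X -> seq X -> V) s :
  f (cuts Phi s) = cuts (fun u v => f (Phi u v)) s.
Proof. exact: raddf_sum. Qed.

(* A separate type, because functions already carry the pointwise ring         *)
(* structure; here the product is the Cauchy product.                          *)
Definition series (X : Type) (A : pzRingType) : Type := seq X -> A.

HB.instance Definition _ (X : Type) (A : pzRingType) :=
  GRing.Zmodule.copy (series X A) (seq X -> A).

(** * The ring of series under the Cauchy product *)

Section SeriesRing.
Variables (X : Type) (A : pzRingType).
Implicit Types (F G H : series X A).

Definition series_one : series X A := fun s => if s is [::] then 1 else 0.

Definition series_mul F G : series X A :=
  cuts (fun u v => F u * G v).

Fact series_mulA : associative series_mul.
Proof.
move=> F G H; apply/funext => s; rewrite /series_mul.
transitivity (cuts (fun u v => cuts (fun v1 v2 => F u * (G v1 * H v2)) v) s).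
  by apply: eq_cuts => u v _; rewrite /cuts mulr_sumr.
rewrite -cutsA; apply: eq_cuts => u v _; rewrite /cuts mulr_suml.
by apply: eq_bigr => i _; rewrite mulrA.
Qed.

Fact series_mul1r : left_id series_one series_mul.
Proof.
move=> F; apply/funext => -[|x s]; first by rewrite /series_mul cuts_nil mul1r.
rewrite /series_mul cuts_cons mul1r cuts0 ?addr0 // => u v _.
by rewrite mul0r.
Qed.

Fact series_mulr1 : right_id series_one series_mul.
Proof.
move=> F; apply/funext => s; rewrite /series_mul.
elim: s F => [|x s IHs] F; first by rewrite cuts_nil mulr1.
by rewrite cuts_cons mulr0 add0r (IHs (fun t => F (x :: t))).
Qed.

Fact series_mulDl : left_distributive series_mul +%R.
Proof.
move=> F G H; apply/funext => s; rewrite -[RHS]/(_ + _) -cutsD.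
by apply: eq_cuts => u v _; rewrite mulrDl.
Qed.

Fact series_mulDr : right_distributive series_mul +%R.
Proof.
move=> F G H; apply/funext => s; rewrite -[RHS]/(_ + _) -cutsD.
by apply: eq_cuts => u v _; rewrite mulrDr.
Qed.

HB.instance Definition _ := GRing.Zmodule_isPzRing.Build (series X A)
  series_mulA series_mul1r series_mulr1 series_mulDl series_mulDr.

Lemma seriesD F G s : (F + G) s = F s + G s. Proof. by []. Qed.
Lemma seriesN F s : (- F) s = - F s. Proof. by []. Qed.
Lemma series1E s : (1 : series X A) s = if s is [::] then 1 else 0.
Proof. by []. Qed.
Lemma seriesM F G s : (F * G) s = cuts (fun u v => F u * G v) s.
Proof. by []. Qed.
Lemma seriesM_nil F G : (F * G) [::] = F [::] * G [::].
Proof. by rewrite seriesM cuts_nil. Qed.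

Definition tail F x : series X A := fun t => F (x :: t).
Lemma seriesM_cons F G x s :
  (F * G) (x :: s) = F [::] * G (x :: s) + (tail F x * G) s.
Proof. exact: cuts_cons. Qed.

Definition scst (a : A) : series X A := fun s => if s is [::] then a else 0.

Lemma scstM a F s : (scst a * F) s = a * F s.
Proof.
case: s => [|x s]; first by rewrite seriesM_nil.
rewrite seriesM_cons /= seriesM cuts0 ?addr0 // => u v _; exact: mul0r.
Qed.

Lemma scstM_scst a b : scst a * scst b = scst (a * b).
Proof.
by apply/funext => s; rewrite scstM; case: s => [|_ _] //=; rewrite mulr0.
Qed.

Fixpoint series_inv_rec F (s : seq X) : A :=
  if s is x :: s' then
    - \sum_(k < (size s').+1) F (x :: take k s') * series_inv_rec F (drop k s')
  else 1.

Definition series_inv F : series X A := series_inv_rec F.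

Lemma series_mulrV F : F [::] = 1 -> F * series_inv F = 1.
Proof.
move=> F0; apply/funext => -[|x s]; first by rewrite seriesM_nil F0 mulr1.
by rewrite seriesM_cons F0 mul1r /= addNr.
Qed.

Lemma series_mulVr F : F [::] = 1 -> series_inv F * F = 1.
Proof.
move=> F0; have V0 : series_inv F [::] = 1 by [].
have eF : F = series_inv (series_inv F).
  by rewrite -[LHS]mulr1 -(series_mulrV V0) mulrA series_mulrV // mul1r.
by rewrite [X in _ * X]eF series_mulrV.
Qed.

Lemma series_inv_eq F G : F [::] = 1 -> F * G = 1 -> series_inv F = G.
Proof.
by move=> F0 FG; rewrite -[RHS]mul1r -(series_mulVr F0) -mulrA FG mulr1.
Qed.

Lemma series_mul1C F G : F [::] = 1 -> F * G = 1 -> G * F = 1.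
Proof. by move=> F0 /(series_inv_eq F0) <-; exact: series_mulVr. Qed.

Lemma series_mul1C_r F G : F [::] = 1 -> G * F = 1 -> F * G = 1.
Proof.
move=> F0 GF; suff -> : G = series_inv F by exact: series_mulrV.
by rewrite -[G]mulr1 -(series_mulrV F0) mulrA GF mul1r.
Qed.

Definition vanish n F := forall s, (size s < n)%N -> F s = 0.

Lemma vanish_mull n F G : vanish n G -> vanish n (F * G).
Proof.
move=> vG s ls; rewrite seriesM cuts0 // => u v e.
by rewrite vG ?mulr0 //; apply: leq_ltn_trans ls; rewrite -e leq_addl.
Qed.

Lemma vanish_mulr n F G : vanish n F -> vanish n (F * G).
Proof.
move=> vF s ls; rewrite seriesM cuts0 // => u v e.
by rewrite vF ?mul0r //; apply: leq_ltn_trans ls; rewrite -e leq_addr.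
Qed.

Lemma vanish_mulS n F G : F [::] = 0 -> vanish n G -> vanish n.+1 (F * G).
Proof.
move=> F0 vG s ls; rewrite seriesM cuts0 // => -[|x u] v e.
  by rewrite F0 mul0r.
by rewrite vG ?mulr0 //; rewrite -ltnS (leq_trans _ ls) // -e /= addSn !ltnS leq_addl.
Qed.

(** Since [Q] has no constant term, the coefficient of [Y] at a word involves only coefficients of
    [Y] at shorter words. This stands in for the expansion P + Q P + Q Q P + ... of [Y]. *)
Lemma series_fix_ind (S : A -> Prop) (P Q Y : series X A) :
  S 0 -> (forall u v, S u -> S v -> S (u + v)) ->
  (forall s y, S y -> S (Q s * y)) ->
  Q [::] = 0 -> Y = P + Q * Y -> (forall s, S (P s)) -> forall s, S (Y s).
Proof.
move=> S0 SD SM Q0 eY SP s.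
elim: {s}(size s) {-2}s (leqnn (size s)) => [|n IHn] s ls;
  rewrite eY seriesD; apply: (SD) => //; rewrite seriesM.
  by move: s ls => [|//] _; rewrite cuts_nil Q0 mul0r.
rewrite /cuts; apply: (big_ind S) => // k _.
case: k => k /= _; case: k => [|k]; first by rewrite take0 Q0 mul0r.
apply: SM; apply: IHn; rewrite size_drop leq_subLR.
by rewrite (leq_trans ls) // addSn ltnS leq_addl.
Qed.

End SeriesRing.

Section SeriesMap.
Variables (X : Type) (A A' : pzRingType).

Definition smap (f : A -> A') (F : series X A) : series X A' :=
  fun s => f (F s).

Fact smap_is_zmod_morphism (f : {additive A -> A'}) :
  zmod_morphism (smap f).
Proof. by move=> F G; apply/funext => s; exact: raddfB. Qed.

HB.instance Definition _ (f : {additive A -> A'}) :=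
  GRing.isZmodMorphism.Build (series X A) (series X A') (smap f)
    (smap_is_zmod_morphism f).

Fact smap_is_monoid_morphism (f : {rmorphism A -> A'}) :
  monoid_morphism (smap f).
Proof.
split=> [|F G]; apply/funext => s.
  by rewrite /smap !series1E; case: s => [|_ _]; rewrite ?rmorph1 ?rmorph0.
rewrite /smap !seriesM raddf_cuts; apply: eq_cuts => u v _; exact: rmorphM.
Qed.

HB.instance Definition _ (f : {rmorphism A -> A'}) :=
  GRing.isMonoidMorphism.Build (series X A) (series X A') (smap f)
    (smap_is_monoid_morphism f).

Lemma smap1 (f : {additive A -> A'}) : f 1 = 1 -> smap f 1 = 1.
Proof.
move=> f1; apply/funext => s.
by rewrite /smap !series1E; case: s => [|_ _]; rewrite ?raddf0.
Qed.

End SeriesMap.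

(** * Substitution of one series into another *)

Section Composition.
Variables (X : Type) (A : pzRingType) (H : seq X -> X).
Implicit Types (F G : series X A).

(* The formula of scomp, with bounds N and M that are independent of s so that *)
(* splitting off the first block gives a recursion.                            *)
Definition scompose_bound N M F s : A :=
  \sum_(k < N.+1)
    \sum_(q : k.-tuple 'I_M.+1
         | all (fun i : 'I_M.+1 => 0 < i)%N q && (\sum_(i <- q) i == size s)%N)
       F [seq H r | r <- reshape [seq val i | i <- q] s].

Definition scompose F : series X A := fun s => scompose_bound (size s) (size s) F s.

Lemma scompose_bound_nil N M F : scompose_bound N M F [::] = F [::].
Proof.
rewrite /scompose_bound big_ord_recl /= [X in _ + X]big1 ?addr0.
  rewrite (big_pred1 [tuple]) /= => [//|q]; rewrite [q]tuple0 /= big_nil.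
  exact/esym/eqP.
move=> k _; apply: big1 => q; case/tupleP: q => i q /=.
by rewrite big_cons addn_eq0 => /andP[/andP[/prednK <-]].
Qed.

(** The first block is [x :: u] with [u] a prefix of [s], and the other blocks cut what remains. The
    bound on [size s] makes every possible first length available in ['I_M.+1]. *)
Lemma scompose_bound_cons N M F x s : (size s < M)%N ->
  scompose_bound N.+1 M F (x :: s) =
  cuts (fun u v => scompose_bound N M (tail F (H (x :: u))) v) s.
Proof.
move=> lsM; rewrite {1}/scompose_bound big_ord_recl /= [X in X + _]big1 ?add0r.
  2: by move=> q; rewrite [q]tuple0 /= big_nil.
transitivity (\sum_(k < N.+1) \sum_(i < M.+1 | (0 < i <= (size s).+1)%N)
  \sum_(q : k.-tuple 'I_M.+1
       | all (fun i : 'I_M.+1 => 0 < i)%N q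
         && (i + \sum_(i <- q) i == (size s).+1)%N)
   F (H (x :: take i.-1 s)
        :: [seq H r | r <- reshape [seq val i | i <- q] (drop i.-1 s)])).
  apply: eq_bigr => k _.
  rewrite (reindex (fun p : 'I_M.+1 * k.-tuple 'I_M.+1 =>
                      [tuple of p.1 :: p.2])) /=; last first.
    exists (fun q : k.+1.-tuple _ => (thead q, [tuple of behead q])).
      by move=> [i q] _; congr (_, _); apply: val_inj.
    by move=> q _; rewrite [RHS]tuple_eta.
  rewrite pair_big_dep /=; apply: eq_big => [[i q]|[i q]] /=.
    rewrite big_cons; case: (posnP i) => [->//|i0]; rewrite /= andbA.
    case: (leqP i (size s).+1) => //= li.
    by apply/negbTE; rewrite negb_and; apply/orP; right;
       apply: contraTneq li => <-; rewrite -leqNgt leq_addr.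
  by case/andP => /andP[i0 _] _; case: i i0 => -[].
(* Block lengths are positive, so the term [i = 0] drops and [i.-1] becomes the length of the prefix
   [u]. *)
rewrite exchange_big /= big_mkcond big_ord_recl /= add0r -big_mkcond /=.
rewrite /cuts (big_ord_widen _ (fun k =>
  scompose_bound N M (tail F (H (x :: take k s))) (drop k s)) lsM).
apply: eq_big => [i|i]; rewrite /= /bump add1n //= ltnS => li.
rewrite add0n; apply: eq_bigr => k _; apply: eq_bigl => q.
by rewrite size_drop -[in LHS](subnKC li) addSn eqSS eqn_add2l.
Qed.

Lemma scompose_bound_indep N N' M M' F s :
  (size s <= N -> size s <= N' -> size s <= M -> size s <= M' ->
  scompose_bound N M F s = scompose_bound N' M' F s)%N.
Proof.
elim: N N' F s => [|N IHN] [|N'] F [|x s] //; rewrite ?scompose_bound_nil //= !ltnS.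
move=> lN lN' lM lM'; rewrite !scompose_bound_cons //.
apply: eq_cuts => u v e; have lv : (size v <= size s)%N by rewrite -e leq_addl.
by apply: IHN; rewrite (leq_trans lv) // ltnW.
Qed.

Lemma scompose_nil F : scompose F [::] = F [::].
Proof. exact: scompose_bound_nil. Qed.

Lemma scompose_cons F x s :
  scompose F (x :: s) = cuts (fun u v => scompose (tail F (H (x :: u))) v) s.
Proof.
rewrite /scompose /= scompose_bound_cons //; apply: eq_cuts => u v e.
have lv : (size v <= size s)%N by rewrite -e leq_addl.
by apply: scompose_bound_indep => //; rewrite ltnW.
Qed.

Fact scompose_is_zmod_morphism : zmod_morphism scompose.
Proof.
move=> F G; apply/funext => s; rewrite -[RHS]/(_ - _) /scompose /scompose_bound.
by rewrite -sumrB; apply: eq_bigr => k _; rewrite -sumrB.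
Qed.

HB.instance Definition _ :=
  GRing.isZmodMorphism.Build (series X A) (series X A) scompose
    scompose_is_zmod_morphism.

Lemma scompose_scst a : scompose (scst a) = scst a.
Proof.
apply/funext => -[|x s]; first exact: scompose_nil.
rewrite scompose_cons; apply: cuts0 => u v _.
exact: (congr1 (fun D : series X A => D v) (raddf0 scompose)).
Qed.

End Composition.

Lemma scompose_smap (X : Type) (A A' : pzRingType) (H : seq X -> X)
    (f : {additive A -> A'}) (F : series X A) :
  scompose H (smap f F) = smap f (scompose H F).
Proof.
apply/funext => s; rewrite /smap /scompose /scompose_bound raddf_sum.
by apply: eq_bigr => k _; rewrite raddf_sum.
Qed.

Section CompositionMorphism.
Variables (X : Type) (A : pzRingType) (H : seq X -> X).
Implicit Types (F G : series X A).

Lemma scompose_scstM a F : scompose H (scst a * F) = scst a * scompose H F.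
Proof.
have aE D : scst a * D = smap (a \*o (idfun : {additive A -> A})) D.
  by apply/funext => s; exact: scstM.
by rewrite !aE scompose_smap.
Qed.

Lemma tailM F G x : tail (F * G) x = scst (F [::]) * tail G x + tail F x * G.
Proof. by apply/funext => s; rewrite /tail seriesM_cons seriesD scstM. Qed.

(** Cutting the list of blocks in two is the same as cutting the word at a block boundary. The
    induction peels off the first block, which falls either to [F] or, if [F] takes no block, to
    [G]. *)
Fact scompose_is_monoid_morphism : monoid_morphism (@scompose X A H).
Proof.
split=> [|F G]; first exact: (scompose_scst H 1).
apply/funext => s.
elim: {s}(size s) {-2}s (leqnn (size s)) F G => [|n IHn] [|x s] // ls F G;
  rewrite ?scompose_nil ?seriesM_nil ?scompose_nil //.
rewrite scompose_cons seriesM_cons scompose_nil scompose_cons.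
under eq_cuts => u v e.
  rewrite tailM raddfD /= scompose_scstM seriesD scstM (IHn v); last first.
    by apply: leq_trans (ls : (size s <= n)%N); rewrite -e leq_addl.
  rewrite seriesM; over.
rewrite cutsD -cutsA; congr (_ + _).
  by rewrite /cuts mulr_sumr.
rewrite seriesM; apply: eq_cuts => u v _.
by rewrite /tail scompose_cons /cuts mulr_suml.
Qed.

HB.instance Definition _ :=
  GRing.isMonoidMorphism.Build (series X A) (series X A) (@scompose X A H)
    scompose_is_monoid_morphism.

(** Any block longer than one leaves fewer than [size s] blocks, where [F] vanishes; on blocks of
    length one [H] is the identity. *)
Lemma scompose_lead F s : (forall x, H [:: x] = x) -> vanish (size s) F ->
  scompose H F s = F s.
Proof.
move=> H1; elim: {s}(size s) {-2}s (leqnn (size s)) F => [|n IHn] [|x s] // ls F;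
  rewrite ?scompose_nil // => vF.
rewrite scompose_cons; case: s ls vF => [|y s] ls vF.
  by rewrite cuts_nil scompose_nil /tail H1.
rewrite cuts_cons H1 cuts0 ?addr0 => [|u v e].
  by rewrite IHn // => t lt; rewrite /tail vF.
have lv : (size v <= size s)%N by rewrite -e leq_addl.
rewrite IHn /tail ?vF //= ?ltnS //.
  by apply: leq_trans lv _; rewrite ltnW // (leq_trans _ ls).
by move=> t lt; rewrite vF //= ltnS (leq_trans lt) // ltnW.
Qed.

Lemma scompose_inj F G : (forall x, H [:: x] = x) ->
  scompose H F = scompose H G -> F = G.
Proof.
move=> H1 e; apply/subr0_eq; have {e} : scompose H (F - G) = 0.
  by rewrite (raddfB (scompose H)) /= e subrr.
move: (F - G) => D D0; suff vD n : vanish n D.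
  by apply/funext => s; exact: (vD (size s).+1).
elim: n => [//|n IHn] s; rewrite ltnS leq_eqVlt => /orP[/eqP es|]; last exact: IHn.
by rewrite -scompose_lead ?D0 // es.
Qed.

End CompositionMorphism.

(** * Noncommutative identities behind the change of variable and the factorisation *)

(** Put x = X - 1 and y = Y - 1. Since (1 - z x)(E - 1) = z x, the left side is (1 - z x)(1 - z y) -
    z x (1 + z) y, in which the two terms z x z y cancel. It is applied both over [A] and over
    [B]. *)
Lemma sub1_mul_factor (S : pzRingType) (z X Y E F : S) :
  (1 - z * (X - 1)) * E = 1 -> F * (1 - z * (Y - 1)) = 1 ->
  (1 - z * (X - 1)) * (1 - (E - 1) * ((1 + z) * (Y - 1) * F)) *
    (1 - z * (Y - 1)) =
  1 - z * (X * Y - 1).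
Proof.
rewrite -{3}(subrK 1 X) -{4}(subrK 1 Y).
move: (X - 1) (Y - 1) => x y xE Fy.
have -> : (x + 1) * (y + 1) - 1 = x + y + x * y.
  by rewrite mulrDl mulrDr mul1r mulr1 addrA addrK [RHS]addrC addrA.
have e1 : (1 - z * x) * (E - 1) = z * x.
  by rewrite mulrBr xE mulr1 opprB addrC subrK.
rewrite (mulrBr (1 - z * x)) mulr1 [_ * (_ * (_ * F))]mulrA e1 mulrBl.
rewrite -(mulrA (z * x)) -(mulrA _ F) Fy mulr1.
rewrite mulrBl mul1r mulrBr mulr1 !mulrDl !mulrDr mul1r !mulrA.
rewrite !(opprB, opprD) !addrA.
by rewrite (ACl (1*4*2*5*(3*6))) /= subrr addr0.
Qed.

(** Here [i] is the variable, [c] the moment series and [c * k] the image of [i] under the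
    substitution. The lemma brings a denominator in the substituted variable back to one in [i]. *)
Lemma sub_mul_cancel (S : pzRingType) (i c k t u : S) :
  k * t = 1 -> (1 - i * k) * c = i ->
  (1 - i * k) * (1 - c * k * (t * u - 1)) = 1 - i * u.
Proof.
move=> kt ic; rewrite mulrBr mulr1 !mulrA ic mulrBr mulr1 -!mulrA [k * _]mulrA.
by rewrite kt mul1r opprB addrA subrK.
Qed.

Section IdentitySeries.
Variables (C : comNzRingType) (B : algType C).
Implicit Types (F G : series B B).

Definition idser : series B B := sI.

Lemma idserM F b s : (idser * F) (b :: s) = b * F s.
Proof.
rewrite seriesM_cons mul0r add0r seriesM; case: s => [|x s].
  by rewrite cuts_nil.
by rewrite cuts_cons cuts0 ?addr0 // => u v _; rewrite mul0r.
Qed.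

Lemma Midser F b s : (F * idser) (rcons s b) = F s * b.
Proof.
elim: s F => [|x s IHs] F.
  by rewrite seriesM_cons seriesM_nil mulr0 addr0.
rewrite rcons_cons seriesM_cons IHs.
by case: s {IHs} => [|y s]; rewrite mulr0 add0r.
Qed.

Lemma idser_injl : injective ( *%R idser).
Proof.
move=> F G e; apply/funext => s.
by rewrite -[LHS]mul1r -[RHS]mul1r -!idserM e.
Qed.

Lemma idser_injr : injective ( *%R^~ idser).
Proof.
move=> F G e; apply/funext => s; rewrite -[LHS]mulr1 -[RHS]mulr1 -!Midser.
exact: (congr1 (fun H : series B B => H _) e).
Qed.

Lemma scompose_idser (H : series B B) : H [::] = 0 -> scompose H idser = H.
Proof.
move=> H0; apply/funext => -[|x s]; rewrite ?scompose_nil // scompose_cons.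
have tE b : tail idser b = scst b by apply/funext => -[|? ?].
transitivity ((tail H x * 1) s); last by rewrite mulr1.
apply: eq_cuts => u v _; rewrite tE scompose_scst series1E.
by case: v => [|? ?]; rewrite ?mulr1 ?mulr0.
Qed.

End IdentitySeries.

(** * Resolvents and the cumulant equations *)

Section Resolvents.
Variables (C : comNzRingType) (A : algType C) (P : {pred A}) (B : subAlgType P).
Implicit Types (F G : series B B) (f : {linear A -> B}).

Local Notation I := (@idser C B).

Definition sincl : series B B -> series B A := smap \val.
HB.instance Definition _ := GRing.RMorphism.on sincl.

Lemma bimodule_mapl f (b : B) x : unital_bimodule_map f ->
  f (\val b * x) = b * f x.
Proof. by case=> _ /(_ b 1 x); rewrite rmorph1 !mulr1. Qed.

Lemma bimodule_mapr f (b : B) x : unital_bimodule_map f ->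
  f (x * \val b) = f x * b.
Proof. by case=> _ /(_ 1 b x); rewrite rmorph1 !mul1r. Qed.

Lemma smap_incll f F (G : series B A) : unital_bimodule_map f ->
  smap f (sincl F * G) = F * smap f G.
Proof.
move=> hf; apply/funext => s; rewrite /smap !seriesM raddf_cuts.
by apply: eq_cuts => u v _; exact: bimodule_mapl.
Qed.

Lemma smap_inclr f (F : series B A) G : unital_bimodule_map f ->
  smap f (F * sincl G) = smap f F * G.
Proof.
move=> hf; apply/funext => s; rewrite /smap !seriesM raddf_cuts.
by apply: eq_cuts => u v _; exact: bimodule_mapr.
Qed.

Definition den (Y : series B A) : series B A := 1 - sincl I * (Y - 1).
Definition resolvent Y := series_inv (den Y).

(* E_x for T = T_x. *)
Definition T_resolvent (T : series B B) (x : A) : series B A :=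
  resolvent (sincl (series_inv T) * scst x).
Definition conj_idser (T : series B B) : series B B := T * I * series_inv T.

Lemma den_nil Y : den Y [::] = 1.
Proof.
by rewrite /den seriesD seriesN seriesM_nil /sincl /smap /= raddf0 mul0r subr0.
Qed.

Lemma den_resolvent Y : den Y * resolvent Y = 1.
Proof. exact/series_mulrV/den_nil. Qed.

Lemma resolvent_den Y : resolvent Y * den Y = 1.
Proof. exact/series_mulVr/den_nil. Qed.

Lemma sinclIM (F : series B A) b s : (sincl I * F) (b :: s) = \val b * F s.
Proof.
rewrite seriesM_cons {1}/sincl /smap /= raddf0 mul0r add0r seriesM.
case: s => [|x s]; first by rewrite cuts_nil.
rewrite cuts_cons cuts0 ?addr0 // => u v _.
by rewrite /tail /sincl /smap /= raddf0 mul0r.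
Qed.

(** The words b_0 x b_1 ... x b_n are the coefficients of the geometric series (1 - I x)^-1 I,
    called [Q] below. *)
Lemma moment_seriesE f x : unital_bimodule_map f ->
  (moment_series f x : series B B) =
  smap f (series_inv (1 - sincl I * scst x)) * I.
Proof.
move=> hf; pose Q : series B A := fun s =>
  if s is b0 :: s' then \val b0 * \prod_(b <- s') (x * \val b) else 0.
have eQ : Q = sincl I + sincl I * scst x * Q.
  apply/funext => s; rewrite seriesD -mulrA.
  case: s => [|b s]; first by rewrite seriesM_nil /sincl /smap /= raddf0 mul0r addr0.
  rewrite sinclIM scstM; case: s => [|c s] /=.
    by rewrite big_nil !mulr1 /sincl /smap /= mulr0 mulr0 addr0.
  by rewrite big_cons /sincl /smap /= raddf0 add0r !mulrA.
have D0 : (1 - sincl I * scst x : series B A) [::] = 1.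
  by rewrite seriesD seriesN seriesM_nil /sincl /smap /= raddf0 mul0r subr0.
have {}eQ : (1 - sincl I * scst x) * Q = sincl I.
  by rewrite mulrBl mul1r {1}eQ addrK.
rewrite -smap_inclr //.
rewrite (_ : _ * sincl I = Q); last first.
  by rewrite -[RHS]mul1r -[X in X * Q](series_mulVr D0) -mulrA eQ.
by apply/funext => -[|b s] //=; rewrite /smap raddf0.
Qed.

Lemma smap_resolvent f psi x (K Kc T Tc : series B B) :
  unital_bimodule_map f -> unital_bimodule_map psi -> T [::] = 1 ->
  free_cumulant_series psi x K -> cfree_cumulant_series f psi x Kc ->
  K =1 (T \os (sI \*s K))%ser -> Kc =1 (Tc \os (sI \*s K))%ser ->
  smap f (T_resolvent T x) * (1 - I * (series_inv T * Tc - 1)) = 1.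
Proof.
move=> hf hpsi T0 [[_ K0] eC] [_ eCf] /funext eK /funext eKc.
set Cx : series B B := moment_series psi x.
set Cf : series B B := moment_series f x.
set G : series B B := I * K.
have {}eK : scompose G T = K by exact/esym.
have {}eKc : scompose G Tc = Kc by exact/esym.
set k := scompose Cx K; set kc := scompose Cx Kc.
have {}eC : Cx = I + I * k * Cx by exact/funext.
have {}eCf : Cf = I + I * kc * Cf by exact/funext.
have G1 b : G [:: b] = b by rewrite /G idserM K0 mulr1.
have C1 b : Cx [:: b] = b.
  by rewrite /Cx /= big_nil bimodule_mapl // hpsi.1 mulr1.
have C0 : Cx [::] = 0 by [].
have G0 : G [::] = 0 by rewrite /G seriesM_nil mul0r.
have comp_incl (F : series B B) H : scompose H (sincl F) = sincl (scompose H F).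
  exact: scompose_smap.
(* [Tv] is the inverse of [k], because the two substitutions carry [T] first to [K] and then to
   [k]. *)
set Tv := scompose Cx (scompose G (series_inv T)).
have kTv : k * Tv = 1.
  by rewrite /k -eK -rmorphM -rmorphM series_mulrV // !rmorph1.
have eIk : (1 - I * k) * Cx = I by rewrite mulrBl mul1r {1}eC addrK.
set M := series_inv (1 - sincl I * scst x).
have MV : M * (1 - sincl I * scst x) = 1.
  apply: series_mulVr.
  by rewrite seriesD seriesN seriesM_nil /sincl /smap /= raddf0 mul0r subr0.
have fM : smap f M * (1 - I * kc) = 1.
  apply: series_mul1C; first by rewrite seriesD seriesN seriesM_nil mul0r subr0.
  apply: idser_injr; rewrite mul1r -mulrA -moment_seriesE //.
  by rewrite mulrBl mul1r -/Cf {1}eCf addrK.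
(* Both substituted series have identity linear part, so it is enough to compare after substituting;
   together they send [I] to [Cx * k]. *)
apply/(scompose_inj G1)/(scompose_inj C1).
rewrite !rmorph1 !(rmorphM (scompose _)) /= !scompose_smap.
set E := scompose Cx (scompose G _).
have eG : scompose Cx G = Cx * k by rewrite rmorphM /= scompose_idser.
have eE : E = M * sincl (1 - I * k).
  have : (1 - sincl (Cx * k) * (sincl Tv * scst x - 1)) * E = 1.
    have := congr1 (fun D => scompose Cx (scompose G D))
      (den_resolvent (sincl (series_inv T) * scst x)).
    rewrite !rmorphM -/E !rmorph1 /den !(rmorphB, rmorphM, rmorph1) /=.
    by rewrite !comp_incl !scompose_scst !scompose_idser // eG rmorphM.
  move=> DE; rewrite -[LHS]mul1r -[X in X * _ = _]MV -mulrA; congr (_ * _).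
  have ikTv := congr1 sincl kTv; rewrite rmorphM rmorph1 in ikTv.
  have ieIk := congr1 sincl eIk; rewrite rmorphM rmorphB rmorph1 rmorphM in ieIk.
  rewrite -(sub_mul_cancel (scst x) ikTv ieIk) rmorphB rmorph1 rmorphM.
  by rewrite rmorphM in DE; rewrite -(mulrA _ _ E) DE mulr1.
rewrite !(rmorphB, rmorphM, rmorph1) /= !scompose_idser // -/Tv eKc -/kc eG.
rewrite eE smap_inclr // -mulrA sub_mul_cancel //.
Qed.

End Resolvents.

(** Conjugation by [t] restores the variable [i] after t i t^-1 has been substituted for it, and
    moves onto [w]. *)
Lemma conj_sub1 (S : pzRingType) (i t tv w : S) : tv * t = 1 ->
  tv * (1 - t * i * tv * (w - 1)) * t = 1 - i * (tv * w * t - 1).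
Proof.
move=> e; rewrite (mulrBr tv) mulrBl mulr1 e; congr (1 - _).
rewrite !mulrA e mul1r -[X in _ = _ * (_ - X)]e -!mulrA -mulrBr.
by rewrite mulrBl mul1r.
Qed.

(** * The resolvent relations determine T and T^c *)

Section Uniqueness.
Variables (C : comNzRingType) (A : algType C) (P : {pred A}) (B : subAlgType P).
Variables (psi : {linear A -> B}) (hpsi : unital_bimodule_map psi).
Local Notation I := (@idser C B).
Implicit Types (U V : series B B) (Y : series B A).

(** Rewriting [den_resolvent] gives E - 1 = I (Y - 1) E. As [I] can be cancelled, psi(E) = 1 also
    makes (Y - 1) E centred. *)
Lemma smap_resolvent_centre (f : {linear A -> B}) Y : unital_bimodule_map f ->
  smap f (resolvent Y) - 1 = I * smap f ((Y - 1) * resolvent Y).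
Proof.
move=> hf; rewrite -smap_incll // mulrA.
rewrite (_ : sincl I * (Y - 1) * resolvent Y = resolvent Y - 1).
  by rewrite raddfB /= smap1 //; case: hf.
by rewrite -[X in _ = _ - X](den_resolvent Y) /den mulrBl mul1r subKr.
Qed.

Lemma resolvent_fixpoint U x : U [::] = 1 ->
  smap psi (T_resolvent U x) = 1 ->
  smap psi (scst x * T_resolvent U x) = U.
Proof.
move=> U0; rewrite /T_resolvent; set Y := sincl _ * _ => e.
have : smap psi ((Y - 1) * resolvent Y) = 0.
  by apply: idser_injl; rewrite -smap_resolvent_centre // e subrr mulr0.
rewrite mulrBl mul1r raddfB /= e -mulrA smap_incll // => /subr0_eq e1.
by rewrite -[LHS]mul1r -(series_mulrV U0) -mulrA e1 mulr1.
Qed.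

Lemma resolvent_inj U V x : U [::] = 1 -> V [::] = 1 ->
  smap psi (T_resolvent U x) = 1 ->
  smap psi (T_resolvent V x) = 1 -> U = V.
Proof.
move=> U0 V0 eU eV.
have := resolvent_fixpoint U0 eU; have := resolvent_fixpoint V0 eV.
rewrite /T_resolvent.
set YU := sincl (series_inv U) * _; set YV := sincl (series_inv V) * _.
set EU := resolvent YU; set EV := resolvent YV => fV fU.
have dY : YU - YV =
    sincl (series_inv U) * (sincl (V - U) * (sincl (series_inv V) * scst x)).
  rewrite /YU /YV -mulrBl !mulrA -!rmorphB -!rmorphM /=; congr (sincl _ * _).
  by rewrite mulrBr mulrBl -mulrA series_mulrV // mulr1 series_mulVr // mul1r.
(* This is the resolvent identity; its factor [sincl I] is what raises the order. *)
have dE : EU - EV = EU * (sincl I * ((YU - YV) * EV)).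
  transitivity (EU * (den YV - den YU) * EV).
    by rewrite mulrBr mulrBl -mulrA den_resolvent mulr1 resolvent_den mul1r.
  rewrite -!mulrA; congr (_ * _); rewrite mulrA; congr (_ * _).
  by rewrite /den opprB [LHS]addrC addrA subrK -mulrBr opprB addrA subrK.
(* By fU, fV, dE and dY, U - V is the image of itself under a map that raises  *)
(* the order by one.                                                           *)
apply/subr0_eq/funext => s.
suff vD n : vanish n (U - V) by exact: (vD (size s).+1).
elim: n => [//|n IHn].
have vanish_smap m (A1 A2 : pzRingType) (f : {additive A1 -> A2})
    (F : series B A1) : vanish m F -> vanish m (smap f F).
  by move=> vF r lr; rewrite /smap vF ?raddf0.
rewrite -fU -fV -raddfB -mulrBr -/EU -/EV dE dY.
apply: (vanish_smap); do 2!apply: vanish_mull; apply: vanish_mulS.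
  by rewrite /sincl /smap /= raddf0.
apply: vanish_mulr; apply: vanish_mull; apply: vanish_mulr.
rewrite -opprB; apply: vanish_smap => r lr.
by rewrite seriesN IHn // oppr0.
Qed.

Lemma sub1_cancel (F T U V : series B B) : T [::] = 1 ->
  F * (1 - I * (series_inv T * U - 1)) = 1 ->
  F * (1 - I * (series_inv T * V - 1)) = 1 -> U = V.
Proof.
move=> T0; set D := fun U => 1 - I * (series_inv T * U - 1) => FU FV.
have FC : D U * F = 1.
  apply: series_mul1C_r FU.
  by rewrite /D seriesD seriesN seriesM_nil mul0r subr0.
have : D U = D V by rewrite -[RHS]mul1r -FC -mulrA FV mulr1.
move=> /addrI/oppr_inj/idser_injl/addIr e.
by rewrite -[U]mul1r -[V]mul1r -(series_mulrV T0) -!mulrA e.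
Qed.

End Uniqueness.

(** * Series with coefficients in the algebra generated by one element *)

Section GeneratedSubalgebra.
Variables (C : comNzRingType) (A : algType C) (P : {pred A}) (B : subAlgType P).
Variable (x : A).
Local Notation gen := (gen_subalg B x).
Local Notation I := (@idser C B).
Implicit Types F G : series B A.

Lemma gen_subalg0 : gen 0.
Proof. by rewrite -(scale0r x); apply: gen_scale; exact: gen_elt. Qed.

Lemma gen_subalgN y : gen y -> gen (- y).
Proof. by move=> gy; rewrite -scaleN1r; exact: gen_scale. Qed.

Lemma gen_subalg_sum (J : Type) (r : seq J) (Q : pred J) (F : J -> A) :
  (forall j, gen (F j)) -> gen (\sum_(j <- r | Q j) F j).
Proof.
by move=> gF; apply: big_ind => // [|y z]; [exact: gen_subalg0|exact: gen_add].
Qed.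

Definition gen_series F := forall s, gen (F s).

Lemma gen_seriesD F G : gen_series F -> gen_series G -> gen_series (F + G).
Proof. by move=> gF gG s; exact: gen_add. Qed.

Lemma gen_seriesN F : gen_series F -> gen_series (- F).
Proof. by move=> gF s; exact: gen_subalgN. Qed.

Lemma gen_seriesM F G : gen_series F -> gen_series G -> gen_series (F * G).
Proof. by move=> gF gG s; apply: gen_subalg_sum => k; exact: gen_mul. Qed.

Lemma gen_series_sincl (F : series B B) : gen_series (sincl F).
Proof. by move=> s; exact: gen_base. Qed.

Lemma gen_series1 : gen_series 1.
Proof. by rewrite -(rmorph1 (@sincl C A P B)); exact: gen_series_sincl. Qed.

Lemma gen_series_scst : gen_series (scst x).
Proof. by case=> [|? ?]; [exact: gen_elt | exact: gen_subalg0]. Qed.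

Lemma gen_series_resolvent F : gen_series F -> gen_series (resolvent F).
Proof.
move=> gF; have gQ : gen_series (sincl I * (F - 1)).
  apply: gen_seriesM; first exact: gen_series_sincl.
  by apply: gen_seriesD => //; apply/gen_seriesN/gen_series1.
apply: (series_fix_ind (P := 1) (Q := sincl I * (F - 1))).
- exact: gen_subalg0.
- exact: gen_add.
- by move=> s y; exact: gen_mul.
- by rewrite seriesM_nil /sincl /smap /= raddf0 mul0r.
- rewrite -[X in _ = X + _](den_resolvent F) /den.
  by rewrite mulrBl mul1r subrK.
- exact: gen_series1.
Qed.

Lemma gen_series_scompose H F : gen_series F -> gen_series (scompose H F).
Proof. by move=> gF s; do 2!(apply: gen_subalg_sum => ?). Qed.

End GeneratedSubalgebra.

(** * Alternating centred words *)

Section Words.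
Variables (C : comNzRingType) (A : algType C) (P : {pred A}) (B : subAlgType P).
Variables (psi f : {linear A -> B}) (a1 a2 : A).
Hypothesis f1 : f 1 = 1.

Definition centred_letter (c : bool) (y : A) : Prop :=
  gen_subalg B (if c then a2 else a1) y /\ psi y = 0.

(** This isolates the property of a single functional [f], so that one argument serves both [phi]
    and [psi]. *)
Definition multiplicative_on_words : Prop :=
  forall w : seq (bool * A), w != [::] ->
    sorted (fun p q => p.1 != q.1) w ->
    (forall p, p \in w -> centred_letter p.1 p.2) ->
    f (\prod_(p <- w) p.2) = \prod_(p <- w) f p.2.

Hypothesis fM : multiplicative_on_words.

(* Holds of all linear combinations of alternating centred words that are     *)
(* empty or start with a letter of type c.                                    *)
Definition absorbs c (y : A) : Prop :=
  forall w : seq (bool * A),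
    sorted (fun i j => i != j) (rcons (unzip1 w) c) ->
    (forall p, p \in w -> centred_letter p.1 p.2) ->
    f (\prod_(p <- w) p.2 * y) = \prod_(p <- w) f p.2 * f y.

Lemma absorbs0 c : absorbs c 0.
Proof. by move=> w _ _; rewrite raddf0 !mulr0 raddf0. Qed.

Lemma absorbsD c y z : absorbs c y -> absorbs c z -> absorbs c (y + z).
Proof.
by move=> cy cz w sw lw; rewrite mulrDr !raddfD mulrDr /= cy // cz.
Qed.

Lemma absorbs_sum c (J : Type) (r : seq J) (Q : pred J) (F : J -> A) :
  (forall j, absorbs c (F j)) -> absorbs c (\sum_(j <- r | Q j) F j).
Proof.
by move=> cF; apply: big_ind => // [|y z]; [exact: absorbs0|exact: absorbsD].
Qed.

Lemma absorbs1 c : absorbs c 1.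
Proof.
move=> [|p w] sw lw; first by rewrite !big_nil mul1r f1 mulr1.
rewrite mulr1 f1 mulr1 fM //.
by move: sw; rewrite /= rcons_path => /andP[]; rewrite path_map.
Qed.

(** The letter [y] is appended to the word on the left, which still alternates, and [z] absorbs the
    longer word. *)
Lemma absorbs_letterM c y z : centred_letter c y -> absorbs (~~ c) z ->
  absorbs c (y * z) /\ f (y * z) = f y * f z.
Proof.
move=> ly az.
have step w : sorted (fun i j => i != j) (rcons (unzip1 w) c) ->
    (forall p, p \in w -> centred_letter p.1 p.2) ->
    f (\prod_(p <- w) p.2 * (y * z)) = \prod_(p <- w) f p.2 * (f y * f z).
  move=> sw lw; have := az (rcons w (c, y)); rewrite !big_rcons /= mulrA => ->.
  - by rewrite mulrA.
  - rewrite /unzip1 map_rcons -/unzip1.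
    case: (unzip1 w) sw => [_|i u] /=; first by case: (c).
    by rewrite !rcons_path last_rcons => ->; case: (c).
  - by move=> p; rewrite mem_rcons inE => /predU1P[->|/lw].
have e : f (y * z) = f y * f z.
  by have := step [::]; rewrite !big_nil !mul1r; apply.
by split=> // w sw lw; rewrite step // e.
Qed.

Implicit Types F G : series B A.

Definition letter_series c F := forall s, centred_letter c (F s).
Definition absorbs_series c F := forall s, absorbs c (F s).

Lemma letter_seriesM c F G : letter_series c F -> absorbs_series (~~ c) G ->
  absorbs_series c (F * G) /\ smap f (F * G) = smap f F * smap f G.
Proof.
move=> lF aG; split=> [s|].
  by apply: absorbs_sum => k; exact: (absorbs_letterM (lF _) (aG _)).1.
apply/funext => s; rewrite /smap !seriesM raddf_cuts.
by apply: eq_cuts => u v _; case: (absorbs_letterM (lF u) (aG v)).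
Qed.

Lemma letter_series_absorbs c F : letter_series c F -> absorbs_series c F.
Proof.
move=> lF s; rewrite -[F s]mulr1.
by case: (absorbs_letterM (lF s) (@absorbs1 _)).
Qed.

(* Z = (1 - F G)^-1 (1 + F) expands into the alternating words that are empty *)
(* or start with a letter of F and end with a letter of F.                    *)
Lemma smap_alternating c F G Z :
  letter_series c F -> letter_series (~~ c) G -> F [::] = 0 ->
  Z = (1 + F) + F * G * Z ->
  absorbs_series c Z /\
  smap f Z = (1 + smap f F) + smap f F * smap f G * smap f Z.
Proof.
move=> lF lG F0 eZ.
have aZ : absorbs_series c Z.
  apply: (series_fix_ind (P := 1 + F) (Q := F * G)).
  - exact: absorbs0.
  - exact: absorbsD.
  - move=> s y ay; rewrite seriesM /cuts mulr_suml; apply: absorbs_sum => k.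
    rewrite -mulrA; apply: (fun h => (absorbs_letterM (lF _) h).1).
    by apply: (fun h => (absorbs_letterM (lG _) h).1); rewrite negbK.
  - by rewrite seriesM_nil F0 mul0r.
  - exact: eZ.
  - move=> s; apply: absorbsD; last exact: letter_series_absorbs.
    by rewrite series1E; case: s => [|_ _]; [exact: absorbs1|exact: absorbs0].
split=> //; have aZ' : absorbs_series (~~ ~~ c) Z by rewrite negbK.
have [aGZ eGZ] := letter_seriesM lG aZ'.
have [_ eFGZ] := letter_seriesM lF aGZ.
by rewrite {1}eZ !raddfD /= smap1 // -mulrA eFGZ eGZ mulrA.
Qed.

End Words.

(** * The resolvent of a product *)

Section Multiplicativity.
Variables (C : comNzRingType) (A : algType C) (P : {pred A}) (B : subAlgType P).
Variables (psi f : {linear A -> B}) (a b : A).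
Hypotheses (hpsi : unital_bimodule_map psi) (hf : unital_bimodule_map f).
Hypothesis fM : multiplicative_on_words psi f a b.
Local Notation I := (@idser C B).

(** With [f] equal to [psi] and each [Tac], [Tbc] equal to [Ta], [Tb], this is the relation that
    determines T_ab; with [f] equal to [phi] it is the one that determines T^c_ab. *)
Lemma smap_resolvent_mul (Ta Tac Tb Tbc : series B B) :
  Ta [::] = 1 -> Tb [::] = 1 ->
  smap psi (T_resolvent Ta a) = 1 -> smap psi (T_resolvent Tb b) = 1 ->
  smap f (T_resolvent Ta a) * (1 - I * (series_inv Ta * Tac - 1)) = 1 ->
  smap f (T_resolvent Tb b) * (1 - I * (series_inv Tb * Tbc - 1)) = 1 ->
  let U := scompose (conj_idser Tb) Ta * Tb in
  let Uc := scompose (conj_idser Tb) Tac * Tbc in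
  smap f (T_resolvent U (a * b)) * (1 - I * (series_inv U * Uc - 1)) = 1.
Proof.
move=> Ta0 Tb0 psia psib fa fb.
set z' := conj_idser Tb => U Uc.
have z'0 : z' [::] = 0 by rewrite /z' /conj_idser !seriesM_nil mulr0 mul0r.
set t := Tb; set tv := series_inv Tb.
have tvt : tv * t = 1 by exact: series_mulVr.
have ttv : t * tv = 1 by exact: series_mulrV.
have z'E : z' = t * I * tv by [].
clearbody z'.
set s := scompose z' Ta; set sv := scompose z' (series_inv Ta).
set sc := scompose z' Tac.
have ssv : s * sv = 1 by rewrite -rmorphM series_mulrV // rmorph1.
have UV : series_inv U = tv * sv.
  have U0 : U [::] = 1 by rewrite /U seriesM_nil scompose_nil Ta0 Tb0 mulr1.
  apply: series_inv_eq => //.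
  by rewrite /U -/s -mulrA (mulrA Tb) ttv mul1r ssv.
(* Moving [t] from [Y] into the conjugation makes [X * Y] equal to (s t)^-1 a b, while [den X]
   becomes a conjugate of the substituted denominator of [a]. *)
pose X := sincl (tv * sv) * scst a * sincl t.
pose Y := sincl tv * scst b.
have XY : X * Y = sincl (series_inv U) * scst (a * b).
  rewrite /X /Y UV -!mulrA (mulrA (sincl t)) -[sincl t * _]rmorphM ttv.
  by rewrite rmorph1 mul1r scstM_scst.
pose Ea := sincl tv * scompose z' (T_resolvent Ta a) * sincl t.
pose F := T_resolvent Tb b.
have FE : F = resolvent Y by [].
have itvt : sincl tv * sincl t = 1 by rewrite -rmorphM tvt rmorph1.
have ittv : sincl t * sincl tv = 1 by rewrite -rmorphM ttv rmorph1.
have dXEa : den X * Ea = 1.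
  have := congr1 (scompose z') (den_resolvent (sincl (series_inv Ta) * scst a)).
  rewrite rmorph1 /den !(rmorphB, rmorphM, rmorph1) /=.
  rewrite !scompose_smap scompose_idser // scompose_scst -/sv => e.
  rewrite /X rmorphM -(mulrA (sincl tv)) -conj_sub1 // /Ea !mulrA.
  rewrite -(mulrA _ (sincl t)) ittv mulr1.
  rewrite -(mulrA (sincl tv)) -!rmorphM -z'E e mulr1.
  exact: itvt.
pose al := Ea - 1; pose G := sincl (1 + I) * ((Y - 1) * F).
have factor : den X * (1 - al * G) * den Y = den (X * Y).
  have -> : G = (1 + sincl I) * (Y - 1) * F.
    by rewrite /G rmorphD rmorph1 mulrA.
  apply: sub1_mul_factor => //.
  by rewrite FE resolvent_den.
have Ea0 : Ea [::] = 1.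
  by have := congr1 (fun D : series B A => D [::]) dXEa;
     rewrite seriesM_nil den_nil mul1r.
have al0 : al [::] = 0 by rewrite /al seriesD seriesN Ea0 subrr.
have N0 : (1 - al * G : series B A) [::] = 1.
  by rewrite seriesD seriesN seriesM_nil al0 mul0r subr0.
pose Z := series_inv (1 - al * G) * Ea.
have NZ : (1 - al * G) * Z = Ea by rewrite mulrA series_mulrV // mul1r.
have resolvE : resolvent (X * Y) = F * Z.
  apply: series_inv_eq; first exact: den_nil.
  rewrite -factor -!mulrA [den Y * _]mulrA FE den_resolvent mul1r NZ.
  exact: dXEa.
have ZE : Z = (1 + al) + al * G * Z.
  by apply/eqP; rewrite -subr_eq -{1}[Z]mul1r -mulrBl NZ addrC subrK.
have smapEa (h : {linear A -> B}) : unital_bimodule_map h ->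
    smap h Ea = tv * scompose z' (smap h (T_resolvent Ta a)) * t.
  by move=> hh; rewrite smap_inclr // smap_incll // scompose_smap.
have smapG (h : {linear A -> B}) : unital_bimodule_map h ->
    smap h G = (1 + I) * smap h ((Y - 1) * F).
  by move=> hh; rewrite smap_incll.
have gena : gen_series a Ea.
  apply/gen_seriesM/gen_series_sincl/gen_seriesM/gen_series_scompose.
    exact: gen_series_sincl.
  apply/gen_series_resolvent/gen_seriesM/gen_series_scst.
  exact: gen_series_sincl.
have genY : gen_series b Y.
  by apply/gen_seriesM/gen_series_scst/gen_series_sincl.
have genF : gen_series b F by exact: gen_series_resolvent.
have gen1 x : gen_series x (- 1 : series B A).
  by apply: gen_seriesN; exact: gen_series1.
have centred_series c D : gen_series (if c then b else a) D ->
    smap psi D = 0 -> letter_series psi a b c D.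
  by move=> gD D0 r; split=> //; exact: (congr1 (fun H : series B B => H r) D0).
have lal : letter_series psi a b false al.
  apply: centred_series; first exact: gen_seriesD.
  rewrite raddfB /= smapEa // psia rmorph1 mulr1 tvt smap1 ?subrr //.
  exact: hpsi.1.
have lG : letter_series psi a b true G.
  apply: centred_series.
    apply: gen_seriesM; first exact: gen_series_sincl.
    by apply: gen_seriesM => //; apply: gen_seriesD.
  rewrite smapG //; suff -> : smap psi ((Y - 1) * F) = 0 by rewrite mulr0.
  apply: idser_injl.
  by rewrite FE -smap_resolvent_centre // -FE psib subrr mulr0.
have lF : letter_series psi a b true (F - 1).
  apply: centred_series; first exact: gen_seriesD.
  rewrite raddfB /= psib smap1 ?subrr //; exact: hpsi.1.
have [aZ fZ] := smap_alternating hf.1 fM lal lG al0 ZE.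
(* [F - 1] consists of centred letters of [b], and the words of [Z] are empty or start with a letter
   of [a], so [f] splits the product. *)
have [_ fFZ] := letter_seriesM lF (aZ : absorbs_series psi f a b (~~ true) Z).
have {}fFZ : smap f (F * Z) = smap f F * smap f Z.
  have fF : smap f F = smap f (F - 1) + 1.
    by rewrite raddfB /= smap1 ?subrK //; exact: hf.1.
  by rewrite fF mulrDl mul1r -fFZ -raddfD mulrBl mul1r subrK.
(* These are the counterparts over [B] of [X] and [Y]; [smap f Ea] and [smap f F] invert the
   corresponding denominators. *)
pose Xc := tv * (sv * sc) * t; pose Yc := tv * Tbc.
have XYc : Xc * Yc = series_inv U * Uc.
  by rewrite UV /Xc /Yc /Uc -/sc -!mulrA (mulrA t) ttv mul1r.
have sub1_nil Q : (1 - I * Q : series B B) [::] = 1.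
  by rewrite seriesD seriesN seriesM_nil mul0r subr0.
have dYc : (1 - I * (Yc - 1)) * smap f F = 1.
  by apply: series_mul1C_r => //; exact: fb.
have dXc : (1 - I * (Xc - 1)) * smap f Ea = 1.
  have := congr1 (scompose z') fa.
  rewrite rmorph1 !(rmorphB, rmorphM, rmorph1) /= scompose_idser //.
  rewrite -/sv -/sc => e.
  apply: series_mul1C_r => //; rewrite /Xc -conj_sub1 // smapEa // !mulrA.
  rewrite -(mulrA _ t) ttv mulr1 -[tv * _ * _]mulrA -z'E e mulr1.
  exact: tvt.
have fG : smap f G = (1 + I) * (Yc - 1) * smap f F.
  rewrite smapG // -mulrA; congr (_ * _); apply: idser_injl.
  rewrite FE -smap_resolvent_centre // -FE -[X in _ - X]dYc.
  by rewrite mulrBl mul1r subKr mulrA.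
rewrite /T_resolvent -XY -XYc resolvE fFZ.
apply: series_mul1C; first exact: sub1_nil.
rewrite -(sub1_mul_factor (E := smap f Ea) (F := smap f F)) //.
have fal : smap f al = smap f Ea - 1.
  by rewrite raddfB /= smap1 //; exact: hf.1.
have NfZ : (1 - (smap f Ea - 1) * smap f G) * smap f Z = smap f Ea.
  by rewrite mulrBl mul1r {1}fZ fal addrK addrC subrK.
rewrite -fG -(mulrA _ _ (smap f F * _)) [(1 - I * (Yc - 1)) * _]mulrA dYc mul1r.
by rewrite -mulrA NfZ.
Qed.

End Multiplicativity.

(** * Conditional freeness and the conclusion *)

Lemma cond_free_words (C : comNzRingType) (A : algType C) (P : {pred A})
    (B : subAlgType P) (phi psi : {linear A -> B}) (a b : A) :
  cond_free phi psi a b ->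
  multiplicative_on_words psi phi a b /\ multiplicative_on_words psi psi a b.
Proof.
move=> hfree; split=> w w0 sw lw; have [psiw phiw] := hfree w w0 sw lw => //.
(* For [psi] both sides are zero: the first letter of the word is already centred. *)
case: w w0 {sw psiw phiw} lw (psiw) => [//|p w] _ lw ->.
by rewrite big_cons (lw p (mem_head _ _)).2 mul0r.
Qed.

Theorem theorem5p2p3 (R : realType) (A : algType R[i])
    (P : {pred A}) (B : subAlgType P)
    (phi psi : {linear A -> B})
    (hphi : unital_bimodule_map phi) (hpsi : unital_bimodule_map psi)
    (a b : A) (hfree : cond_free phi psi a b)
    (hphia : phi a = 1) (hphib : phi b = 1)
    (hpsia : psi a = 1) (hpsib : psi b = 1)
    (K Kc T Tc : A -> seq B -> B)
    (hK : forall x : A, x \in [:: a; b; a * b] ->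
       [/\ free_cumulant_series psi x (K x),
           cfree_cumulant_series phi psi x (Kc x),
           in_C0 (T x) /\ K x =1 (T x \os (sI \*s K x))%ser
         & in_C0 (Tc x) /\ Kc x =1 (Tc x \os (sI \*s K x))%ser]) :
  T (a * b) =1
    ((T a \os (T b \*s sI \*s sinv (T b))) \*s T b)%ser /\
  Tc (a * b) =1
    ((Tc a \os (T b \*s sI \*s sinv (T b))) \*s Tc b)%ser.
Proof.
have [phiM psiM] := cond_free_words hfree.
have data x : x \in [:: a; b; a * b] ->
  [/\ T x [::] = 1, smap psi (T_resolvent (T x) x) = 1
    & smap phi (T_resolvent (T x) x) *
        (1 - @idser _ B * (series_inv (T x) * Tc x - 1)) = 1].
  move=> /hK[KC KcC [[_ T0] eT] [_ eTc]]; split=> //.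
    (* The free cumulant equation is the conditionally free one with [phi] replaced by [psi], so [T]
       takes the place of [Tc] and the second factor is 1. *)
    have := smap_resolvent hpsi hpsi T0 KC KC eT eT.
    by rewrite series_mulVr // subrr mulr0 subr0 mulr1.
  exact: smap_resolvent hphi hpsi T0 KC KcC eT eTc.
have [|Ta0 psia phia] := data a; first by rewrite !inE eqxx.
have [|Tb0 psib phib] := data b; first by rewrite !inE eqxx orbT.
have [|Tab0 psiab phiab] := data (a * b); first by rewrite !inE eqxx !orbT.
have psi_unit x : T x [::] = 1 -> smap psi (T_resolvent (T x) x) = 1 ->
    smap psi (T_resolvent (T x) x) *
      (1 - @idser _ B * (series_inv (T x) * T x - 1)) = 1.
  by move=> T0 ->; rewrite series_mulVr // subrr mulr0 subr0 mulr1.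
have := smap_resolvent_mul hpsi hphi phiM Ta0 Tb0 psia psib phia phib.
have := smap_resolvent_mul hpsi hpsi psiM Ta0 Tb0 psia psib
  (psi_unit _ Ta0 psia) (psi_unit _ Tb0 psib).
cbv zeta; set U := scompose _ (T a) * _; set Uc := scompose _ (Tc a) * _.
have U0 : U [::] = 1 by rewrite /U seriesM_nil scompose_nil Ta0 Tb0 mulr1.
rewrite series_mulVr // subrr mulr0 subr0 mulr1 => psiU phiU.
have eU : U = T (a * b) :> series B B := resolvent_inj hpsi U0 Tab0 psiU psiab.
rewrite eU in phiU; have eUc := sub1_cancel Tab0 phiU phiab.
split=> s.
  exact: (congr1 (fun F : series B B => F s) (esym eU)).
exact: (congr1 (fun F : series B B => F s) (esym eUc)).
Qed.
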